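(* Let $\mathcal{SH}$, $\mathcal{CSH}$, $\mathcal{AT}1$, $\mathcal{AT}2$, $\mathcal{BT}1$, $\mathcal{BT}2$ be the logics and $\mathbb{CSH}$, $\mathbb{AT}1$, $\mathbb{AT}2$, $\mathbb{BT}1$, $\mathbb{BT}2$ the varieties described in the context. Then the varieties $\mathbb{CSH}$, $\mathbb{AT}1$, $\mathbb{AT}2$, $\mathbb{BT}1$ and $\mathbb{BT}2$ are, respectively, equivalent algebraic semantics of the logics $\mathcal{CSH}$, $\mathcal{AT}1$, $\mathcal{AT}2$, $\mathcal{BT}1$ and $\mathcal{BT}2$.
   Context: Formulas are built from a countable set of propositional variables using the binary connectives $\vee,\wedge,\to$ and the constants $\bot,\top$. Put $\neg\alpha:=\alpha\to\bot$ and $\alpha\to_H\beta:=\alpha\to(\alpha\wedge\beta)$. The semi-intuitionistic (semi-Heyting) logic $\mathcal{SH}$ is the Hilbert-style logic with axioms (all instances of): (A1) $\alpha\to_H(\alpha\vee\beta)$; (A2) $\beta\to_H(\alpha\vee\beta)$; (A3) $(\alpha\to_H\gamma)\to_H[(\beta\to_H\gamma)\to_H((\alpha\vee\beta)\to_H\gamma)]$; (A4) $(\alpha\wedge\beta)\to_H\alpha$; (A5) $(\gamma\to_H\alpha)\to_H[(\gamma\to_H\beta)\to_H(\gamma\to_H(\alpha\wedge\beta))]$; (A6) $\top$; (A7) $\bot\to_H\alpha$; (A8) $((\alpha\wedge\beta)\to_H\gamma)\to_H(\alpha\to_H(\beta\to_H\gamma))$; (A9) $(\alpha\to_H(\beta\to_H\gamma))\to_H((\alpha\wedge\beta)\to_H\gamma)$;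 (A10) $(\alpha\to_H\beta)\to_H((\beta\to_H\alpha)\to_H((\alpha\to\gamma)\to_H(\beta\to\gamma)))$; (A11) $(\alpha\to_H\beta)\to_H((\beta\to_H\alpha)\to_H((\gamma\to\beta)\to_H(\gamma\to\alpha)))$; and the single rule: from $\varphi$ and $\varphi\to_H\gamma$ infer $\gamma$. An axiomatic extension adds further axiom schemes and keeps the same rule. $\mathcal{AT}1$, $\mathcal{AT}2$, $\mathcal{BT}1$, $\mathcal{BT}2$ are the extensions of $\mathcal{SH}$ by, respectively, (AT1) $\neg(\neg\alpha\to\alpha)$, (AT2) $\neg(\alpha\to\neg\alpha)$, (BT1) $(\alpha\to\beta)\to\neg(\alpha\to\neg\beta)$, (BT2) $(\alpha\to\neg\beta)\to\neg(\alpha\to\beta)$; $\mathcal{CSH}$ is the extension of $\mathcal{SH}$ by all four. A semi-Heyting algebra is an algebra $\langle A;\wedge,\vee,\to,0,1\rangle$ that is a bounded lattice satisfying $x\wedge(x\to y)\approx x\wedge y$, $x\wedge(y\to z)\approx x\wedge((x\wedge y)\to(x\wedge z))$ and $x\to x\approx1$; $\mathbb{SH}$ is the variety of these, and $x^*:=x\to0$. $\mathbb{AT}1,\mathbb{AT}2,\mathbb{BT}1,\mathbb{BT}2$ are the subvarieties of $\mathbb{SH}$ defined respectively by $(x^*\to x)^*\approx1$, $(x\to x^* )^*\approx1$, $(x\to y)\to(x\to y^* )^*\approx1$, $(x\to y^* )\to(x\to y)^*\approx1$; $\mathbb{CSH}$ is defined by all four. For a class $\mathbb K$ of algebras, $\Theta\models_{\mathbb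 K}\alpha\approx\beta$ means: for every $\mathbf A\in\mathbb K$ and every homomorphism $h$ from the formula algebra into $\mathbf A$, if $h\varphi=h\psi$ for all $\varphi\approx\psi\in\Theta$ then $h\alpha=h\beta$ (the constants $\bot,\top$ are interpreted as $0,1$). $\mathbb K$ is an equivalent algebraic semantics of a logic $\vdash$ if there are a finite set of identities $\{\delta_i(x)\approx\varepsilon_i(x):i<n\}$ in one variable and a finite set $\{\Delta_j(p,q):j<m\}$ of formulas in two variables such that (1) for all $\Gamma\cup\{\varphi\}$: $\Gamma\vdash\varphi$ iff $\{\delta_i(\psi)\approx\varepsilon_i(\psi):i<n,\psi\in\Gamma\}\models_{\mathbb K}\delta_j(\varphi)\approx\varepsilon_j(\varphi)$ for each $j<n$; and (2) for all formulas $\varphi,\psi$, the identity $\varphi\approx\psi$ and the set $\{\delta_i(\Delta_j(\varphi,\psi))\approx\varepsilon_i(\Delta_j(\varphi,\psi)):i<n,j<m\}$ are mutually $\models_{\mathbb K}$-consequences of each other. *)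

(* Defs.v *)
From Stdlib Require Import List.

Set Implicit Arguments.
Unset Strict Implicit.

(* The variables range over a type [V]: [form nat] is the language of the
   logics, while [form unit] and [form bool] are the formulas in one variable
   and in two variables. *)
Inductive form (V : Type) : Type :=
| Var : V -> form V
| Or  : form V -> form V -> form V
| And : form V -> form V -> form V
| Imp : form V -> form V -> form V
| Bot : form V
| Top : form V.

Arguments Bot {V}.
Arguments Top {V}.

Declare Scope form_scope.
Delimit Scope form_scope with form.
Bind Scope form_scope with form.

Definition Neg (V : Type) (a : form V) : form V := Imp a Bot.
Definition ImpH (V : Type) (a b : form V) : form V := Imp a (And a b).

Notation "a '∧' b" := (And a b) (at level 40, left associativity) : form_scope.
Notation "a '∨' b" := (Or a b) (at level 50, left associativity) : form_scope.
Notation "a '→' b" := (Imp a b) (at level 55, right associativity) : form_scope.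
Notation "a '→H' b" := (ImpH a b) (at level 55, right associativity) : form_scope.
Notation "'¬' a" := (Neg a) (at level 35, right associativity) : form_scope.

Fixpoint subst (V W : Type) (s : V -> form W) (a : form V) : form W :=
  match a with
  | Var v => s v
  | Or a b => Or (subst s a) (subst s b)
  | And a b => And (subst s a) (subst s b)
  | Imp a b => Imp (subst s a) (subst s b)
  | Bot => Bot
  | Top => Top
  end.

Definition formula : Type := form nat.

Definition inst1 (d : form unit) (a : formula) : formula :=
  subst (fun _ => a) d.

(* The first variable is [true], the second one is [false]. *)
Definition inst2 (d : form bool) (a b : formula) : formula :=
  subst (fun v : bool => if v then a else b) d.

Section Schemes.
Local Open Scope form_scope.

Inductive SH_axiom : formula -> Prop :=
| A1 a b : SH_axiom (a →H (a ∨ b))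
| A2 a b : SH_axiom (b →H (a ∨ b))
| A3 a b c : SH_axiom ((a →H c) →H ((b →H c) →H ((a ∨ b) →H c)))
| A4 a b : SH_axiom ((a ∧ b) →H a)
| A5 a b c : SH_axiom ((c →H a) →H ((c →H b) →H (c →H (a ∧ b))))
| A6 : SH_axiom Top
| A7 a : SH_axiom (Bot →H a)
| A8 a b c : SH_axiom (((a ∧ b) →H c) →H (a →H (b →H c)))
| A9 a b c : SH_axiom ((a →H (b →H c)) →H ((a ∧ b) →H c))
| A10 a b c : SH_axiom ((a →H b) →H ((b →H a) →H ((a → c) →H (b → c))))
| A11 a b c : SH_axiom ((a →H b) →H ((b →H a) →H ((c → b) →H (c → a)))).

Inductive AT1_axiom : formula -> Prop :=
| AT1_intro a : AT1_axiom (¬ (¬ a → a)).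

Inductive AT2_axiom : formula -> Prop :=
| AT2_intro a : AT2_axiom (¬ (a → ¬ a)).

Inductive BT1_axiom : formula -> Prop :=
| BT1_intro a b : BT1_axiom ((a → b) → ¬ (a → ¬ b)).

Inductive BT2_axiom : formula -> Prop :=
| BT2_intro a b : BT2_axiom ((a → ¬ b) → ¬ (a → b)).

Inductive CSH_axiom : formula -> Prop :=
| CSH_AT1 a : AT1_axiom a -> CSH_axiom a
| CSH_AT2 a : AT2_axiom a -> CSH_axiom a
| CSH_BT1 a : BT1_axiom a -> CSH_axiom a
| CSH_BT2 a : BT2_axiom a -> CSH_axiom a.

End Schemes.

Definition logic : Type := (formula -> Prop) -> formula -> Prop.

Inductive derives (Ax Gamma : formula -> Prop) : formula -> Prop :=
| d_axiom a : Ax a -> derives Ax Gamma a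
| d_premise a : Gamma a -> derives Ax Gamma a
| d_mp a b : derives Ax Gamma a -> derives Ax Gamma (ImpH a b) ->
             derives Ax Gamma b.

Definition SH_logic : logic := derives SH_axiom.

Definition extension (Ax : formula -> Prop) : logic :=
  derives (fun a => SH_axiom a \/ Ax a).

Definition AT1_logic : logic := extension AT1_axiom.
Definition AT2_logic : logic := extension AT2_axiom.
Definition BT1_logic : logic := extension BT1_axiom.
Definition BT2_logic : logic := extension BT2_axiom.
Definition CSH_logic : logic := extension CSH_axiom.

(* A bare signature on an arbitrary carrier, so that the formulas also form
   an algebra; in particular equality on the carrier need not be decidable. *)
Record algebra : Type := Algebra {
  carrier :> Type;
  meet : carrier -> carrier -> carrier;
  join : carrier -> carrier -> carrier;
  imp : carrier -> carrier -> carrier;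
  zero : carrier;
  one : carrier
}.

Arguments meet {a}.
Arguments join {a}.
Arguments imp {a}.
Arguments zero {a}.
Arguments one {a}.

Definition star (A : algebra) (x : A) : A := imp x zero.

Definition formula_algebra : algebra :=
  @Algebra formula (@And nat) (@Or nat) (@Imp nat) (@Bot nat) (@Top nat).

Record is_hom (A B : algebra) (h : A -> B) : Prop := {
  hom_meet : forall x y, h (meet x y) = meet (h x) (h y);
  hom_join : forall x y, h (join x y) = join (h x) (h y);
  hom_imp : forall x y, h (imp x y) = imp (h x) (h y);
  hom_zero : h zero = zero;
  hom_one : h one = one
}.

Record is_bounded_lattice (A : algebra) : Prop := {
  meetC : forall x y : A, meet x y = meet y x;
  meetA : forall x y z : A, meet x (meet y z) = meet (meet x y) z;
  joinC : forall x y : A, join x y = join y x;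
  joinA : forall x y z : A, join x (join y z) = join (join x y) z;
  meetK : forall x y : A, meet x (join x y) = x;
  joinK : forall x y : A, join x (meet x y) = x;
  join0 : forall x : A, join x zero = x;
  meet1 : forall x : A, meet x one = x
}.

Record SH (A : algebra) : Prop := {
  SH_lattice : is_bounded_lattice A;
  SH_meet_imp : forall x y : A, meet x (imp x y) = meet x y;
  SH_meet_imp_meet : forall x y z : A,
    meet x (imp y z) = meet x (imp (meet x y) (meet x z));
  SH_imp_refl : forall x : A, imp x x = one
}.

Definition AT1 (A : algebra) : Prop :=
  SH A /\ forall x : A, star (imp (star x) x) = one.

Definition AT2 (A : algebra) : Prop :=
  SH A /\ forall x : A, star (imp x (star x)) = one.

Definition BT1 (A : algebra) : Prop :=
  SH A /\ forall x y : A, imp (imp x y) (star (imp x (star y))) = one.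

Definition BT2 (A : algebra) : Prop :=
  SH A /\ forall x y : A, imp (imp x (star y)) (star (imp x y)) = one.

Definition CSH (A : algebra) : Prop :=
  AT1 A /\ AT2 A /\ BT1 A /\ BT2 A.

(* The pair [(a, b)] stands for the identity [a ≈ b]. *)
Definition identity : Type := (formula * formula)%type.

Definition models (K : algebra -> Prop) (Theta : identity -> Prop)
    (e : identity) : Prop :=
  forall (A : algebra), K A ->
  forall h : formula_algebra -> A, is_hom h ->
    (forall t, Theta t -> h (fst t) = h (snd t)) -> h (fst e) = h (snd e).

Definition inst_id (de : form unit * form unit) (a : formula) : identity :=
  (inst1 (fst de) a, inst1 (snd de) a).

Definition equivalent_algebraic_semantics
    (K : algebra -> Prop) (L : logic) : Prop :=
  exists (E : list (form unit * form unit)) (Delta : list (form bool)),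
    (forall (Gamma : formula -> Prop) (a : formula),
       L Gamma a <->
       (forall de, In de E ->
          models K (fun t => exists de' b,
                      In de' E /\ Gamma b /\ t = inst_id de' b)
                 (inst_id de a)))
    /\
    (forall a b : formula,
       (forall de d, In de E -> In d Delta ->
          models K (fun t => t = (a, b)) (inst_id de (inst2 d a b)))
       /\
       models K (fun t => exists de d,
                   In de E /\ In d Delta /\ t = inst_id de (inst2 d a b))
              (a, b)).

(* Main.v *)
(** The identity [x ≈ 1] and the formulas [x →H y], [y →H x] witness the
    equivalence.  In a semi-Heyting algebra [→H] is the residual of the meet,
    so [x →H y = 1] says [x ≤ y], whence soundness.  For completeness one forms
    the Lindenbaum algebra of a set of premises.  The delicate point is that
    [→H] is reflexive and transitive, because neither the second projection nor
    exchange is an axiom.  Reflexivity: [a ∧ ⊤] and [a ∧ a] are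
    interderivable, so (A11) turns [a → (a ∧ ⊤)], that is [a →H ⊤], into
    [a → (a ∧ a)], that is [a →H a].  Transitivity also rests on the
    replacement axioms (A10) and (A11). *)
From Stdlib Require Import List Setoid.
From Stdlib Require Import FunctionalExtensionality PropExtensionality.
From Stdlib Require Import ProofIrrelevance IndefiniteDescription.
Require Import Defs.

Set Implicit Arguments.
Unset Strict Implicit.

(** * Order and residuation in a semi-Heyting algebra *)

Section SemiHeyting.
Context (A : algebra) (SHA : SH A).

Let LA : is_bounded_lattice A := SH_lattice SHA.

Definition le (x y : A) : Prop := meet x y = x.
Definition himp (x y : A) : A := imp x (meet x y).

Lemma meet_idem (x : A) : meet x x = x.
Proof. rewrite <- (joinK LA x x) at 2; apply (meetK LA). Qed.

Lemma le_refl (x : A) : le x x.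
Proof. apply meet_idem. Qed.

Lemma le_trans (x y z : A) : le x y -> le y z -> le x z.
Proof.
unfold le; intros xy yz.
now rewrite <- xy, <- (meetA LA), yz.
Qed.

Lemma le_antisym (x y : A) : le x y -> le y x -> x = y.
Proof. unfold le; intros xy yx; now rewrite <- xy, (meetC LA). Qed.

Lemma le_meetl (x y : A) : le (meet x y) x.
Proof. unfold le; now rewrite (meetC LA), (meetA LA), meet_idem. Qed.

Lemma le_meetr (x y : A) : le (meet x y) y.
Proof. rewrite (meetC LA); apply le_meetl. Qed.

Lemma le_meet (z x y : A) : le z x -> le z y -> le z (meet x y).
Proof. unfold le; intros zx zy; now rewrite (meetA LA), zx. Qed.

Lemma le_one (x : A) : le x one.
Proof. apply (meet1 LA). Qed.

Lemma le_joinP (x y : A) : le x y <-> join x y = y.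
Proof.
unfold le; split; intros E.
- rewrite <- E, (joinC LA), (meetC LA); apply (joinK LA).
- rewrite <- E; apply (meetK LA).
Qed.

Lemma le_joinl (x y : A) : le x (join x y).
Proof. apply (meetK LA). Qed.

Lemma le_joinr (x y : A) : le y (join x y).
Proof. rewrite (joinC LA); apply le_joinl. Qed.

Lemma join_le (x y z : A) : le x z -> le y z -> le (join x y) z.
Proof.
rewrite !le_joinP; intros xz yz; now rewrite <- (joinA LA), yz.
Qed.

Lemma le_zero (x : A) : le zero x.
Proof. apply le_joinP; rewrite (joinC LA); apply (join0 LA). Qed.

(** Forwards, [x ∧ (x → (x ∧ y))] collapses to [x ∧ y]. Backwards, distributing [z] into the
    implication makes antecedent and consequent both equal to [z ∧ x], so the implication is
    [one]. *)
Lemma le_himp (z x y : A) : le z (himp x y) <-> le (meet z x) y.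
Proof.
split; intros H.
- apply le_trans with (meet x (himp x y)).
  + apply le_meet; [apply le_meetr|].
    now apply le_trans with z; [apply le_meetl|].
  + unfold himp; rewrite (SH_meet_imp SHA).
    apply le_trans with (meet x y); apply le_meetr.
- unfold le, himp.
  rewrite (SH_meet_imp_meet SHA), (meetA LA), H, (SH_imp_refl SHA).
  apply (meet1 LA).
Qed.

Lemma himp_one (x y : A) : himp x y = one <-> le x y.
Proof.
split; intros H.
- apply le_trans with (meet one x); [apply le_meet|].
  + apply le_one.
  + apply le_refl.
  + apply le_himp; rewrite H; apply le_refl.
- apply le_antisym; [apply le_one|].
  now apply le_himp, le_trans with x; [apply le_meetr|].
Qed.

Lemma meet_himp_eq (z a b : A) :
  le z (himp a b) -> le z (himp b a) -> meet z a = meet z b.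
Proof.
rewrite !le_himp; intros ab ba.
apply le_antisym; apply le_meet; trivial; apply le_meetl.
Qed.

(** Algebraic content of (A10): the semi-Heyting law moves [z] inside the implication, where [z ∧ a]
    and [z ∧ b] coincide, and then back out. *)
Lemma le_imp_congl (z a b c : A) :
  le z (himp a b) -> le z (himp b a) -> le (meet z (imp a c)) (imp b c).
Proof.
intros ab ba.
rewrite (SH_meet_imp_meet SHA z a), (meet_himp_eq ab ba).
rewrite <- (SH_meet_imp_meet SHA); apply le_meetr.
Qed.

Lemma le_imp_congr (z a b c : A) :
  le z (himp a b) -> le z (himp b a) -> le (meet z (imp c b)) (imp c a).
Proof.
intros ab ba.
rewrite (SH_meet_imp_meet SHA z c b), <- (meet_himp_eq ab ba).
rewrite <- (SH_meet_imp_meet SHA); apply le_meetr.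
Qed.

(** * Soundness under a homomorphism into a semi-Heyting algebra *)

Context (h : formula_algebra -> A) (Hh : is_hom h).

Lemma hom_Imp a b : h (Imp a b) = imp (h a) (h b).
Proof. exact (hom_imp Hh a b). Qed.

Lemma hom_Bot : h Bot = zero.
Proof. exact (hom_zero Hh). Qed.

Lemma hom_Top : h Top = one.
Proof. exact (hom_one Hh). Qed.

Lemma hom_And a b : h (And a b) = meet (h a) (h b).
Proof. exact (hom_meet Hh a b). Qed.

Lemma hom_Or a b : h (Or a b) = join (h a) (h b).
Proof. exact (hom_join Hh a b). Qed.

Lemma hom_ImpH a b : h (ImpH a b) = himp (h a) (h b).
Proof. unfold ImpH; now rewrite hom_Imp, hom_And. Qed.

Lemma hom_Neg a : h (Neg a) = star (h a).
Proof. unfold Neg; now rewrite hom_Imp, hom_Bot. Qed.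

Lemma SH_axiom_sound a : SH_axiom a -> h a = one.
Proof.
intros [b c|b c|b c d|b c|b c d| |b|b c d|b c d|b c d|b c d];
  rewrite ?hom_ImpH, ?hom_Or, ?hom_And, ?hom_Imp, ?hom_Bot, ?hom_Top;
  rewrite ?himp_one.
- apply le_joinl.
- apply le_joinr.
(* For (A3), residuation isolates the join on the left, so the two disjuncts are treated separately
   and no distributivity has to be proved. *)
- rewrite !le_himp, (meetC LA).
  rewrite <- le_himp; apply join_le; rewrite le_himp, (meetC LA), <- le_himp.
  + apply le_meetl.
  + apply le_meetr.
- apply le_meetl.
- rewrite !le_himp.
  apply le_meet; rewrite <- le_himp; [apply le_meetl|apply le_meetr].
- reflexivity.
- apply le_zero.
- rewrite !le_himp, <- (meetA LA), <- le_himp; apply le_refl.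
- rewrite !le_himp, (meetA LA), <- !le_himp; apply le_refl.
- rewrite !le_himp; apply le_imp_congl; [apply le_meetl|apply le_meetr].
- rewrite !le_himp; apply le_imp_congr; [apply le_meetl|apply le_meetr].
Qed.

Lemma derives_sound (Ax Gamma : formula -> Prop) a :
  (forall b, Ax b -> h b = one) -> (forall b, Gamma b -> h b = one) ->
  derives Ax Gamma a -> h a = one.
Proof.
intros HAx HG; induction 1 as [b Hb|b Hb|b c _ IHb _ IHc]; auto.
(* The major premise now says that [one] lies below [h c]. *)
rewrite hom_ImpH, himp_one, IHb in IHc.
apply le_antisym; trivial; apply le_one.
Qed.

End SemiHeyting.

(** * Derived rules of the Hilbert calculus *)

Section Deduction.
Context (Ax Gamma : formula -> Prop) (SHAx : forall a, SH_axiom a -> Ax a).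

Notation T := (derives Ax Gamma).
Notation "a <= b" := (T (ImpH a b)).
Notation "a == b" := (a <= b /\ b <= a) (at level 70).

Lemma T_axiom a : SH_axiom a -> T a.
Proof. intros H; apply d_axiom; auto. Qed.

Lemma le_pair a b c : c <= a -> c <= b -> c <= And a b.
Proof. intros ca cb; exact (d_mp cb (d_mp ca (T_axiom (A5 a b c)))). Qed.

Lemma And_le1 a b : And a b <= a.
Proof. exact (T_axiom (A4 a b)). Qed.

Lemma ImpH_curry a b c : And a b <= c -> a <= ImpH b c.
Proof. intros H; exact (d_mp H (T_axiom (A8 a b c))). Qed.

Lemma ImpH_uncurry a b c : a <= ImpH b c -> And a b <= c.
Proof. intros H; exact (d_mp H (T_axiom (A9 a b c))). Qed.

(** Weakening, by currying the first projection. Followed by [ImpH_uncurry], it adds a left conjunct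
    to a provable [→H]. *)
Lemma le_provable a b : T a -> b <= a.
Proof. intros H; exact (d_mp H (ImpH_curry (And_le1 a b))). Qed.

Lemma Imp_congl a b c : a == b -> T (Imp a c) -> T (Imp b c).
Proof.
intros [ab ba] H; exact (d_mp H (d_mp ba (d_mp ab (T_axiom (A10 a b c))))).
Qed.

Lemma Imp_congr a b c : a == b -> T (Imp c b) -> T (Imp c a).
Proof.
intros [ab ba] H; exact (d_mp H (d_mp ba (d_mp ab (T_axiom (A11 a b c))))).
Qed.

Lemma ImpH_refl a : a <= a.
Proof.
apply Imp_congr with (And a Top).
- split; apply le_pair; try apply And_le1.
  apply le_provable, T_axiom, A6.
- exact (le_provable a (T_axiom A6)).
Qed.

(** The second projection is [b →H b], weakened by [a] and uncurried. *)
Lemma And_le2 a b : And a b <= b.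
Proof. apply ImpH_uncurry, le_provable, ImpH_refl. Qed.

Lemma And_comm a b : And a b == And b a.
Proof. split; apply le_pair; (apply And_le2 || apply And_le1). Qed.

Lemma And_monor a b c : a <= b -> And c a <= And c b.
Proof.
intros ab; apply le_pair; [apply And_le1|].
now apply ImpH_uncurry, le_provable.
Qed.

(* The chain [a ∧ c], [c ∧ a], [c ∧ b], [b ∧ c] is walked one use of (A11) at
   a time, since interderivability is not yet known to be transitive. *)
Lemma ImpH_congl a b c : a == b -> a <= c -> b <= c.
Proof.
intros ab ac.
apply Imp_congr with (And c b); [apply And_comm|].
apply Imp_congr with (And c a).
  { split; apply And_monor; apply ab. }
apply Imp_congr with (And a c); [apply And_comm|].
exact (Imp_congl ab ac).
Qed.

(** Given [a <= b], the formulas [a] and [a ∧ b] are interderivable. Weakening [b <= c] by [a] gives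
    [a ∧ b <= c], and replacement on the left then yields [a <= c]. *)
Lemma ImpH_trans b a c : a <= b -> b <= c -> a <= c.
Proof.
intros ab bc; apply ImpH_congl with (And a b).
- split; [apply And_le1|]; apply le_pair; trivial; apply ImpH_refl.
- now apply ImpH_uncurry, le_provable.
Qed.

Lemma And_mono a b c d : a <= c -> b <= d -> And a b <= And c d.
Proof.
intros ac bd; apply le_pair.
- apply ImpH_trans with a; trivial; apply And_le1.
- apply ImpH_trans with b; trivial; apply And_le2.
Qed.

Lemma le_Or1 a b : a <= Or a b.
Proof. exact (T_axiom (A1 a b)). Qed.

Lemma le_Or2 a b : b <= Or a b.
Proof. exact (T_axiom (A2 a b)). Qed.

Lemma Or_le a b c : a <= c -> b <= c -> Or a b <= c.
Proof. intros ac bc; exact (d_mp bc (d_mp ac (T_axiom (A3 a b c)))). Qed.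

Lemma Bot_le a : Bot <= a.
Proof. exact (T_axiom (A7 a)). Qed.

Lemma Or_mono a b c d : a <= c -> b <= d -> Or a b <= Or c d.
Proof.
intros ac bd; apply Or_le.
- apply ImpH_trans with c; trivial; apply le_Or1.
- apply ImpH_trans with d; trivial; apply le_Or2.
Qed.

(** Modus ponens relative to a hypothesis [a]; it allows (A10) and (A11) to be used under
    assumptions. *)
Lemma le_apply a b c : a <= b -> a <= ImpH b c -> a <= c.
Proof.
intros ab abc; apply ImpH_trans with (And a b); [|now apply ImpH_uncurry].
apply le_pair; trivial; apply ImpH_refl.
Qed.

Lemma le_Imp_congl z a b c :
  And z a <= b -> And z b <= a -> And z (Imp a c) <= Imp b c.
Proof.
intros ab ba; apply ImpH_uncurry.
apply le_apply with (ImpH b a); [now apply ImpH_curry|].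
apply le_apply with (ImpH a b); [now apply ImpH_curry|].
apply le_provable, T_axiom, A10.
Qed.

Lemma le_Imp_congr z a b c :
  And z a <= b -> And z b <= a -> And z (Imp c a) <= Imp c b.
Proof.
intros ab ba; apply ImpH_uncurry.
apply le_apply with (ImpH a b); [now apply ImpH_curry|].
apply le_apply with (ImpH b a); [now apply ImpH_curry|].
apply le_provable, T_axiom, A11.
Qed.

Lemma Imp_le_congl a b c : a == b -> Imp a c <= Imp b c.
Proof. intros [ab ba]; exact (d_mp ba (d_mp ab (T_axiom (A10 a b c)))). Qed.

Lemma Imp_le_congr a b c : a == b -> Imp c b <= Imp c a.
Proof. intros [ab ba]; exact (d_mp ba (d_mp ab (T_axiom (A11 a b c)))). Qed.

Lemma Imp_congruence a b c d : a == c -> b == d -> Imp a b <= Imp c d.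
Proof.
intros ac bd; apply ImpH_trans with (Imp c b).
- now apply Imp_le_congl.
- apply Imp_le_congr; tauto.
Qed.

(** Since [a →H a] is [a → (a ∧ a)], it remains to replace [a ∧ a] by [a] in the consequent. *)
Lemma Imp_refl a : T (Imp a a).
Proof.
apply Imp_congr with (And a a); [|exact (ImpH_refl a)].
split; [|apply And_le1]; apply le_pair; apply ImpH_refl.
Qed.

(** Under the hypothesis [a], each [d] is equivalent to [a ∧ d]; the facts [l] and [r] express this.
    Antecedent and consequent are replaced one after the other. *)
Lemma And_Imp_And a b c :
  And a (Imp b c) == And a (Imp (And a b) (And a c)).
Proof.
assert (l : forall d, And a d <= And a d) by (intros; apply ImpH_refl).
assert (r : forall d, And a (And a d) <= d).
  { intros d; apply ImpH_trans with (And a d); apply And_le2. }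
split; apply le_pair; try apply And_le1.
- apply ImpH_trans with (And a (Imp (And a b) c)).
  + apply le_pair; [apply And_le1|].
    apply le_Imp_congl; [apply l|apply r].
  + apply le_Imp_congr; [apply l|apply r].
- apply ImpH_trans with (And a (Imp b (And a c))).
  + apply le_pair; [apply And_le1|].
    apply le_Imp_congl; [apply r|apply l].
  + apply le_Imp_congr; [apply r|apply l].
Qed.

(** Under [a], the consequent [b] may be exchanged for [a ∧ b], which turns [a → b] into [a →H b];
    currying and uncurrying then apply. *)
Lemma And_Imp a b : And a (Imp a b) == And a b.
Proof.
assert (l : And a b <= And a b) by apply ImpH_refl.
assert (r : And a (And a b) <= b)
  by (apply ImpH_trans with (And a b); apply And_le2).
split; apply le_pair; try apply And_le1.
- apply ImpH_trans with (And a (ImpH a b)).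
  + apply le_pair; [apply And_le1|now apply le_Imp_congr].
  + apply ImpH_trans with (And (ImpH a b) a); [apply And_comm|].
    apply ImpH_uncurry, ImpH_refl.
- apply ImpH_trans with (And a (ImpH a b)).
  + apply le_pair; [apply And_le1|].
    apply ImpH_curry, ImpH_trans with (And a b); [apply And_le1|apply And_le2].
  + now apply le_Imp_congr.
Qed.

(** * The Lindenbaum algebra of a set of premises *)

Definition cls (a : formula) : formula -> Prop := fun b => a == b.

Lemma cls_eqP a b : cls a = cls b <-> a == b.
Proof.
split.
- intros E; change (cls a b); rewrite E; split; apply ImpH_refl.
- intros [ab ba]; apply functional_extensionality; intros c.
  apply propositional_extensionality; split; intros [H1 H2]; split;
  (eapply ImpH_trans; eassumption).
Qed.

(** Classes are predicates, so extensionality makes interderivable formulas equal in the carrier, as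
    identities stated with equality require. *)
Definition quot : Type := {P : formula -> Prop | exists a, P = cls a}.

Definition pi (a : formula) : quot := exist _ (cls a) (ex_intro _ a eq_refl).

Definition repr (x : quot) : formula :=
  proj1_sig (constructive_indefinite_description _ (proj2_sig x)).

Lemma pi_repr x : pi (repr x) = x.
Proof.
unfold repr; destruct (constructive_indefinite_description _ _) as [a Ha].
destruct x as [P HP]; simpl in *; subst P.
unfold pi; f_equal; apply proof_irrelevance.
Qed.

Lemma pi_eqP a b : pi a = pi b <-> a == b.
Proof.
rewrite <- cls_eqP; split.
- intros E; exact (f_equal (@proj1_sig _ _) E).
- intros E; unfold pi.
  apply eq_sig_hprop; [intros; apply proof_irrelevance|exact E].
Qed.

Lemma repr_pi a : repr (pi a) == a.
Proof. apply pi_eqP, pi_repr. Qed.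

Definition lindenbaum : algebra :=
  @Algebra quot
    (fun x y => pi (And (repr x) (repr y)))
    (fun x y => pi (Or (repr x) (repr y)))
    (fun x y => pi (Imp (repr x) (repr y)))
    (pi Bot) (pi Top).

(** The operations act on chosen representatives, so compatibility of interderivability with the
    connectives enters here. *)
Lemma pi_hom : @is_hom formula_algebra lindenbaum pi.
Proof.
split; simpl; trivial; intros a b; apply pi_eqP;
  destruct (repr_pi a), (repr_pi b); split.
- now apply And_mono.
- now apply And_mono.
- now apply Or_mono.
- now apply Or_mono.
- now apply Imp_congruence.
- now apply Imp_congruence.
Qed.

(** Key to completeness: truth under [pi] is exactly derivability from [Gamma]. *)
Lemma pi_eq_Top a : pi a = pi Top <-> T a.
Proof.
rewrite pi_eqP; split.
- intros [_ H]; exact (d_mp (T_axiom A6) H).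
- intros H; split; apply le_provable; trivial; apply T_axiom, A6.
Qed.

Lemma lindenbaum_ind (P : lindenbaum -> Prop) :
  (forall a, P (pi a)) -> forall x, P x.
Proof. intros H x; rewrite <- (pi_repr x); apply H. Qed.

Lemma pi_And a b : @meet lindenbaum (pi a) (pi b) = pi (And a b).
Proof. symmetry; exact (hom_meet pi_hom a b). Qed.

Lemma pi_Or a b : @join lindenbaum (pi a) (pi b) = pi (Or a b).
Proof. symmetry; exact (hom_join pi_hom a b). Qed.

Lemma pi_Imp a b : @imp lindenbaum (pi a) (pi b) = pi (Imp a b).
Proof. symmetry; exact (hom_imp pi_hom a b). Qed.

Lemma pi_Neg a : @star lindenbaum (pi a) = pi (Neg a).
Proof. exact (pi_Imp a Bot). Qed.

Lemma SH_lindenbaum : SH lindenbaum.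
Proof.
split; [split|..];
  (* Every element is written as the class of a formula and the operations are pushed inside [pi],
     so that each identity becomes an interderivability. *)
  repeat match goal with
  | |- forall x : carrier lindenbaum, _ => refine (lindenbaum_ind _); intros ?
  end;
  rewrite ?pi_Imp, ?pi_And, ?pi_Or;
  change (@zero lindenbaum) with (pi Bot);
  change (@one lindenbaum) with (pi Top);
  rewrite ?pi_And, ?pi_Or, ?pi_Imp, ?pi_And; apply pi_eqP.
- apply And_comm.
- split; repeat apply le_pair; eauto using And_le1, And_le2, ImpH_trans.
- split; apply Or_le; auto using le_Or1, le_Or2.
- split; repeat apply Or_le; eauto using le_Or1, le_Or2, ImpH_trans.
- split; [apply And_le1|apply le_pair; [apply ImpH_refl|apply le_Or1]].
- split; [apply Or_le; [apply ImpH_refl|apply And_le1]|apply le_Or1].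
- split; [apply Or_le; [apply ImpH_refl|apply Bot_le]|apply le_Or1].
- split; [apply And_le1|apply le_pair; [apply ImpH_refl|]].
  apply le_provable, T_axiom, A6.
- apply And_Imp.
- apply And_Imp_And.
- split; apply le_provable; [apply T_axiom, A6|apply Imp_refl].
Qed.

(** At a class [pi a] the identity says that an instance of (AT1) is derivable. Allowing any [Ax]
    that contains the scheme lets the lemma serve [CSH] as well. *)
Lemma AT1_lindenbaum : (forall a, AT1_axiom a -> Ax a) -> AT1 lindenbaum.
Proof.
intros H; split; [exact SH_lindenbaum|]; refine (lindenbaum_ind _); intros a.
rewrite !pi_Neg, pi_Imp, pi_Neg; apply pi_eq_Top, d_axiom, H, AT1_intro.
Qed.

Lemma AT2_lindenbaum : (forall a, AT2_axiom a -> Ax a) -> AT2 lindenbaum.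
Proof.
intros H; split; [exact SH_lindenbaum|]; refine (lindenbaum_ind _); intros a.
rewrite !pi_Neg, pi_Imp, pi_Neg; apply pi_eq_Top, d_axiom, H, AT2_intro.
Qed.

Lemma BT1_lindenbaum : (forall a, BT1_axiom a -> Ax a) -> BT1 lindenbaum.
Proof.
intros H; split; [exact SH_lindenbaum|].
refine (lindenbaum_ind _); intros a; refine (lindenbaum_ind _); intros b.
rewrite !pi_Neg, !pi_Imp, pi_Neg, pi_Imp.
apply pi_eq_Top, d_axiom, H, BT1_intro.
Qed.

Lemma BT2_lindenbaum : (forall a, BT2_axiom a -> Ax a) -> BT2 lindenbaum.
Proof.
intros H; split; [exact SH_lindenbaum|].
refine (lindenbaum_ind _); intros a; refine (lindenbaum_ind _); intros b.
rewrite !pi_Neg, !pi_Imp, pi_Neg, pi_Imp.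
apply pi_eq_Top, d_axiom, H, BT2_intro.
Qed.

End Deduction.

(** * Validity of the additional axioms and algebraizability *)

Definition axioms_valid (K : algebra -> Prop) (Ax : formula -> Prop) : Prop :=
  forall A, K A -> forall h : formula_algebra -> A, is_hom h ->
  forall a, Ax a -> h a = one.

Lemma AT1_axioms_valid : axioms_valid AT1 AT1_axiom.
Proof.
intros A [_ HA] h Hh _ [a].
rewrite (hom_Neg Hh), (hom_Imp Hh), (hom_Neg Hh); apply HA.
Qed.

Lemma AT2_axioms_valid : axioms_valid AT2 AT2_axiom.
Proof.
intros A [_ HA] h Hh _ [a].
rewrite (hom_Neg Hh), (hom_Imp Hh), (hom_Neg Hh); apply HA.
Qed.

Lemma BT1_axioms_valid : axioms_valid BT1 BT1_axiom.
Proof.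
intros A [_ HA] h Hh _ [a b].
rewrite (hom_Imp Hh), (hom_Neg Hh), !(hom_Imp Hh), (hom_Neg Hh); apply HA.
Qed.

Lemma BT2_axioms_valid : axioms_valid BT2 BT2_axiom.
Proof.
intros A [_ HA] h Hh _ [a b].
rewrite (hom_Imp Hh), (hom_Neg Hh), !(hom_Imp Hh), (hom_Neg Hh); apply HA.
Qed.

Lemma CSH_axioms_valid : axioms_valid CSH CSH_axiom.
Proof.
intros A [H1 [H2 [H3 H4]]] h Hh a [b Hb|b Hb|b Hb|b Hb].
- exact (AT1_axioms_valid H1 Hh Hb).
- exact (AT2_axioms_valid H2 Hh Hb).
- exact (BT1_axioms_valid H3 Hh Hb).
- exact (BT2_axioms_valid H4 Hh Hb).
Qed.

(** What depends on the extension is isolated in the hypotheses: validity of the new axioms gives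
    soundness, and membership of the Lindenbaum algebras in [K] gives completeness. *)
Lemma extension_algebraizable (K : algebra -> Prop) (Ax : formula -> Prop) :
  (forall A, K A -> SH A) -> axioms_valid K Ax ->
  (forall Gamma, K (lindenbaum (fun a => SH_axiom a \/ Ax a) Gamma)) ->
  equivalent_algebraic_semantics K (extension Ax).
Proof.
intros KSH KAx KL.
exists ((Var tt, Top) :: nil).
exists (ImpH (Var true) (Var false) :: ImpH (Var false) (Var true) :: nil).
split.
- intros Gamma a; split.
  + intros D de [<-|[]] A KA h Hh HG.
    change (h a = h Top); rewrite (hom_Top Hh).
    apply (derives_sound (KSH A KA) Hh) with (3 := D).
    * intros b [Hb|Hb]; [exact (SH_axiom_sound (KSH A KA) Hh Hb)|].
      exact (KAx A KA h Hh b Hb).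
    * intros b Hb; rewrite <- (hom_Top Hh).
      apply (HG (b, Top)); exists (Var tt, Top), b; simpl; auto.
  + intros H.
    assert (SHAx : forall b, SH_axiom b -> SH_axiom b \/ Ax b) by auto.
    apply (pi_eq_Top Gamma SHAx).
    (* The semantic consequence is evaluated at [pi], under which every premise, being derivable,
       takes the value [pi Top]. *)
    apply (H (Var tt, Top) (or_introl eq_refl) _ (KL Gamma) _
             (pi_hom Gamma SHAx)).
    intros t (de & b & [<-|[]] & Hb & ->); simpl.
    now apply (pi_eq_Top Gamma SHAx), d_premise.
- intros a b; split.
  + intros de d [<-|[]] Hd A KA h Hh HT.
    assert (E : h a = h b) by exact (HT (a, b) eq_refl).
    change (h (inst2 d a b) = h Top); rewrite (hom_Top Hh).
    destruct Hd as [<-|[<-|[]]];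
      [change (h (ImpH a b) = one)|change (h (ImpH b a) = one)];
      rewrite (hom_ImpH Hh), (himp_one (KSH A KA)), E;
      apply (le_refl (KSH A KA)).
  + intros A KA h Hh HT; simpl in *.
    assert (Hd : forall d,
        In d (ImpH (Var true) (Var false) :: ImpH (Var false) (Var true) :: nil)
        -> h (inst2 d a b) = one).
      { intros d Hd; rewrite <- (hom_Top Hh).
        apply (HT (inst2 d a b, Top)); exists (Var tt, Top), d; simpl; auto. }
    (* The two formulas of [Delta] supply the two inequalities. *)
    apply (le_antisym (KSH A KA)); apply (himp_one (KSH A KA));
      rewrite <- (hom_ImpH Hh).
    * exact (Hd (ImpH (Var true) (Var false)) (or_introl eq_refl)).
    * exact (Hd (ImpH (Var false) (Var true)) (or_intror (or_introl eq_refl))).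
Qed.

Theorem theorem4p2 :
  equivalent_algebraic_semantics CSH CSH_logic /\
  equivalent_algebraic_semantics AT1 AT1_logic /\
  equivalent_algebraic_semantics AT2 AT2_logic /\
  equivalent_algebraic_semantics BT1 BT1_logic /\
  equivalent_algebraic_semantics BT2 BT2_logic.
Proof.
refine (conj _ (conj _ (conj _ (conj _ _)))); apply extension_algebraizable.
- intros A [[HA _] _]; exact HA.
- exact CSH_axioms_valid.
- intros Gamma; split; [|split; [|split]].
  + apply AT1_lindenbaum; auto using CSH_AT1.
  + apply AT2_lindenbaum; auto using CSH_AT2.
  + apply BT1_lindenbaum; auto using CSH_BT1.
  + apply BT2_lindenbaum; auto using CSH_BT2.
- intros A [HA _]; exact HA.
- exact AT1_axioms_valid.
- intros Gamma; apply AT1_lindenbaum; auto.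
- intros A [HA _]; exact HA.
- exact AT2_axioms_valid.
- intros Gamma; apply AT2_lindenbaum; auto.
- intros A [HA _]; exact HA.
- exact BT1_axioms_valid.
- intros Gamma; apply BT1_lindenbaum; auto.
- intros A [HA _]; exact HA.
- exact BT2_axioms_valid.
- intros Gamma; apply BT2_lindenbaum; auto.
Qed.
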